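(* Let $X$ be a finite set partitioned as $X = X_1 \cup X_2$ with $X_1 \neq \emptyset$ and $X_2 \neq \emptyset$. Let $\mathcal{F} \subseteq 2^X$ be a 1-part intersecting, 1-part Sperner set system of maximum size. Then $|\mathcal{F}| = 2^{|X|-2}$.
   Context: For $F \subseteq X$, the sets $F \cap X_1$ and $F \cap X_2$ are called the traces of $F$ on $X_1$ and $X_2$. A system $\mathcal{F} \subseteq 2^X$ is 1-part intersecting, 1-part Sperner if there is no pair of distinct sets $F_1, F_2 \in \mathcal{F}$ and index $i \in \{1,2\}$ (with $j$ the other index) such that the traces $F_1 \cap X_i$ and $F_2 \cap X_i$ are disjoint while the traces $F_1 \cap X_j$ and $F_2 \cap X_j$ are in containment, i.e. one of them is a subset (not necessarily proper) of the other. *)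

(* Defs.v *)
From mathcomp Require Import all_boot.

Set Implicit Arguments.
Unset Strict Implicit.
Unset Printing Implicit Defensive.

Definition disjoint_on (T : finType) (A F1 F2 : {set T}) : bool :=
  [disjoint F1 :&: A & F2 :&: A].

(* Containment is non-strict, so equal traces are in containment. *)
Definition contained_on (T : finType) (A F1 F2 : {set T}) : bool :=
  (F1 :&: A \subset F2 :&: A) || (F2 :&: A \subset F1 :&: A).

Definition one_part_intersecting_sperner (T : finType) (X1 X2 : {set T})
    (F : {set {set T}}) : Prop :=
  forall F1 F2 : {set T}, F1 \in F -> F2 \in F -> F1 != F2 ->
    ~ (disjoint_on X1 F1 F2 /\ contained_on X2 F1 F2) /\
    ~ (disjoint_on X2 F1 F2 /\ contained_on X1 F1 F2).

(* Maximum cardinality among all such systems, not maximality for inclusion. *)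
Definition maximum_one_part_intersecting_sperner (T : finType)
    (X1 X2 : {set T}) (F : {set {set T}}) : Prop :=
  one_part_intersecting_sperner X1 X2 F /\
  forall G : {set {set T}},
    one_part_intersecting_sperner X1 X2 G -> #|G| <= #|F|.

(* Main.v *)
(** Slice F by the trace on X2: for B included in X2, let F_B be the traces on
    X1 of the members of F whose trace on X2 is B.  Each slice is intersecting
    (unless it is {set0}, in which case the opposite slice is empty), and the
    slices at B and at X2 \ B are cross-incomparable.  If U and V are
    the up-closures of two such slices in the cube of size N = 2^|X1|, the
    slices lie in U \ V and V \ U, while |U|, |V| <= N/2, and Kleitman's
    inequality |U||V| <= N |U & V| gives
      2N(|U \ V| + |V \ U|) <= 2N(|U| + |V|) - 4|U||V|
                             = N^2 - (N - 2|U|)(N - 2|V|) <= N^2.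
    Summing over all B counts F twice.  Equality is attained by the sets
    containing two fixed points, one in each part. *)
Require Import Defs.
From mathcomp Require Import all_boot.
From mathcomp Require Import zify.

Section Cube.

Variable T : finType.
Implicit Types (x : T) (A B D S : {set T}) (F G : {set {set T}}).
Implicit Types P Q : pred {set T}.

Lemma card_subsets_setU1 x D P : x \notin D ->
  #|[set S in powerset (x |: D) | P S]| =
  #|[set S in powerset D | P S]| + #|[set S in powerset D | P (x |: S)]|.
Proof.
move=> xD; rewrite -(cardsID [set S : {set T} | x \in S]) addnC.
have notin S : S \subset D -> x \notin S.
  by move=> SD; apply: contra xD => /(subsetP SD).
congr (_ + _).
  apply: eq_card => S; rewrite !inE.
  case xS: (x \in S) => /=; first by apply/esym/negP=> /andP[/notin]; rewrite xS.
  by rewrite -subDset; have /setDidPl-> : [disjoint S & [set x]]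
    by rewrite disjoint_sym disjoints1 xS.
rewrite -[RHS](card_in_imset (f := fun S => x |: S)); last first.
  move=> S1 S2; rewrite !inE => /andP[/notin n1 _] /andP[/notin n2 _] e.
  by rewrite -(setU1K n1) e setU1K.
apply: eq_card => S; rewrite !inE; apply/idP/imsetP.
  case/andP=> /andP[SD PS] xS; exists (S :\ x); last by rewrite setD1K.
  by rewrite !inE setD1K // PS subDset SD.
by case=> S'; rewrite !inE => /andP[SD PS] ->; rewrite setU11 PS setUS.
Qed.

(** Induction on [#|D|], splitting the subsets of [D] by whether they contain a chosen [x].
    Monotonicity is asked on all sets, not only inside [D], so that [S] ↦ [P (x |: S)] inherits it
    at once. *)
Lemma kleitman_upsets D P Q :
    (forall S S', S \subset S' -> P S -> P S') ->
    (forall S S', S \subset S' -> Q S -> Q S') ->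
  #|[set S in powerset D | P S]| * #|[set S in powerset D | Q S]| <=
  2 ^ #|D| * #|[set S in powerset D | P S && Q S]|.
Proof.
have [n] := ubnP #|D|; elim: n => // n IHn in D P Q *.
move=> leDn monoP monoQ; have [->|[x xD]] := set_0Vmem D.
  rewrite cards0 mul1n; have sub (R : pred {set T}) :
      [set S in powerset (@set0 T) | R S] = if R set0 then [set set0] else set0.
    apply/setP=> S; rewrite !inE subset0.
    by case: eqVneq => [->|/negPf nS]; case: (R set0); rewrite ?inE ?eqxx ?nS.
  by rewrite !sub; case: (P _); case: (Q _); rewrite ?cards1 ?cards0.
have xD' : x \notin D :\ x by rewrite setD11.
have leD' : #|D :\ x| < n by move: leDn; rewrite (cardsD1 x D) xD.
have monoU (R : pred {set T}) : (forall S S', S \subset S' -> R S -> R S') ->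
    forall S S' : {set T}, S \subset S' -> R (x |: S) -> R (x |: S').
  by move=> monoR S S' sSS'; apply: monoR; apply: setUS.
have le01 (R : pred {set T}) : (forall S S', S \subset S' -> R S -> R S') ->
    #|[set S in powerset (D :\ x) | R S]| <=
    #|[set S in powerset (D :\ x) | R (x |: S)]|.
  move=> monoR; apply/subset_leq_card/subsetP=> S; rewrite !inE => /andP[-> /=].
  by apply: monoR; apply: subsetUr.
have h0 := IHn _ P Q leD' monoP monoQ.
have h1 := IHn _ (fun S => P (x |: S)) (fun S => Q (x |: S)) leD'
  (monoU _ monoP) (monoU _ monoQ).
have := le01 _ monoQ; have := le01 _ monoP; move: h0 h1 => /=.
move: (D :\ x) xD' (setD1K xD) => D' xD' <-.
rewrite !card_subsets_setU1 // cardsU1 xD' add1n expnS.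
set p0 := #|[set S in _ | P S]|; set p1 := #|[set S in _ | P (x |: S)]|.
set q0 := #|[set S in _ | Q S]|; set q1 := #|[set S in _ | Q (x |: S)]|.
set r0 := #|[set S in _ | P S && _]|; set r1 := #|[set S in _ | _ && _]|.
move: p0 p1 q0 q1 r0 r1 (2 ^ _) => p0 p1 q0 q1 r0 r1 N h0 h1 hp hq.
(* Since [p0 <= p1] and [q0 <= q1], the product [(p1 - p0) * (q1 - q0)] is nonnegative, hence [(p0 +
   p1) * (q0 + q1) <= 2 * (p0 * q0 + p1 * q1)]; [h0] and [h1] bound the two products. *)
nia.
Qed.

Definition up_closed_by F : pred {set T} :=
  fun S => [exists A in F, A \subset S].

Lemma up_closed_by_mono F S S' :
  S \subset S' -> up_closed_by F S -> up_closed_by F S'.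
Proof.
move=> sSS' /exists_inP[A FA AS]; apply/exists_inP; exists A => //.
exact: subset_trans sSS'.
Qed.

Lemma mem_up_closed_by F A : A \in F -> up_closed_by F A.
Proof. by move=> FA; apply/exists_inP; exists A. Qed.

Lemma setDK D S : S \subset D -> D :\: (D :\: S) = S.
Proof. by rewrite setDDr setDv set0U => /setIidPr. Qed.

(** Complementation in [D] sends the up-closure injectively to a family disjoint from it: otherwise
    [S] and its complement would contain disjoint members of [F]. The hypothesis includes [A = B],
    which keeps [set0] out of [F]. *)
Lemma card_up_intersecting D F :
    {in F &, forall A B, ~~ [disjoint A & B]} ->
  2 * #|[set S in powerset D | up_closed_by F S]| <= 2 ^ #|D|.
Proof.
move=> intF; set U := [set S in _ | _].
have injC : {in U &, injective (fun S => D :\: S)}.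
  move=> S1 S2; rewrite !inE => /andP[/setDK s1 _] /andP[/setDK s2 _] e.
  by rewrite -s1 e.
rewrite mul2n -addnn -{2}(card_in_imset injC) -card_powerset.
have dis : [disjoint U & (fun S => D :\: S) @: U].
  rewrite disjoint_subset; apply/subsetP=> S; rewrite !inE => /andP[_ /exists_inP[A FA AS]].
  apply/imsetP=> -[S']; rewrite !inE => /andP[_ /exists_inP[B FB BS]] eS.
  move/negP: (intF A B FA FB); apply.
  rewrite disjoint_sym (disjointWl BS) // disjoint_sym (disjointWl AS) // eS.
  by rewrite disjoint_sym disjoints_subset setCD subsetUr.
move: (dis); rewrite -leq_card_setU => /eqP<-.
apply/subset_leq_card; rewrite subUset; apply/andP; split.
  by apply/subsetP=> S; rewrite !inE => /andP[].
by apply/subsetP=> _ /imsetP[S _ ->]; rewrite inE subsetDl.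
Qed.

Lemma card_cross_sperner_intersecting D F G : D != set0 ->
    F \subset powerset D -> G \subset powerset D ->
    {in F &, forall A B, A != B -> ~~ [disjoint A & B]} ->
    {in G &, forall A B, A != B -> ~~ [disjoint A & B]} ->
    {in F & G, forall A B, ~~ ((A \subset B) || (B \subset A))} ->
  2 * (#|F| + #|G|) <= 2 ^ #|D|.
Proof.
move=> D0.
(* The empty set is disjoint from every set and comparable to every set, so the two families are
   [[set set0]] and [set0]; the bound becomes [2 <= 2 ^ #|D|], whence [D != set0]. *)
have empty (F' G' : {set {set T}}) : set0 \in F' ->
    {in F' &, forall A B, A != B -> ~~ [disjoint A & B]} ->
    {in F' & G', forall A B, ~~ ((A \subset B) || (B \subset A))} ->
    2 * (#|F'| + #|G'|) <= 2 ^ #|D|.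
  move=> F'0 intF' cross.
  have -> : G' = set0.
    by apply/setP=> B; rewrite inE; apply/negP=> /(cross _ _ F'0); rewrite sub0set.
  have -> : F' = [set set0].
    apply/setP=> B; rewrite inE; apply/idP/eqP => [F'B|-> //]; apply/eqP.
    case: eqVneq => // nB; have := intF' _ _ F'B F'0 nB.
    by rewrite disjoints_subset setC0 subsetT.
  by rewrite cards1 cards0; apply: (@leq_pexp2l 2 1); rewrite ?card_gt0.
move=> FD GD intF intG cross.
have [F0|F0] := boolP (set0 \in F); first exact: empty.
have [G0|G0] := boolP (set0 \in G).
  by rewrite addnC; apply: empty => // A B GA FB; rewrite orbC; apply: cross.
have strict (H : {set {set T}}) : set0 \notin H ->
    {in H &, forall A B, A != B -> ~~ [disjoint A & B]} ->
    {in H &, forall A B, ~~ [disjoint A & B]}.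
  move=> H0 intH A B HA HB; have [<-|] := eqVneq A B; last exact: intH.
  by rewrite -setI_eq0 setIid; apply: contraNneq H0 => <-.
have hF := card_up_intersecting D _ (strict _ F0 intF).
have hG := card_up_intersecting D _ (strict _ G0 intG).
have := kleitman_upsets D _ _ (up_closed_by_mono F) (up_closed_by_mono G).
move: hF hG; set U := [set S in _ | up_closed_by F S].
set V := [set S in _ | up_closed_by G S]; set W := [set S in _ | _ && _].
have WE : W = U :&: V by apply/setP=> S; rewrite !inE; case: (_ \subset _).
have FU : #|F| + #|W| <= #|U|.
  rewrite -(cardsID V U) -WE addnC leq_add2l; apply/subset_leq_card/subsetP=> A FA.
  have := subsetP FD _ FA; rewrite !inE => -> /=; rewrite (mem_up_closed_by _ _ FA) andbT.
  by apply/exists_inP=> -[B GB BA]; have := cross _ _ FA GB; rewrite BA orbT.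
have GV : #|G| + #|W| <= #|V|.
  rewrite -(cardsID U V) setIC -WE addnC leq_add2l; apply/subset_leq_card/subsetP=> B GB.
  have := subsetP GD _ GB; rewrite !inE => -> /=; rewrite (mem_up_closed_by _ _ GB) andbT.
  by apply/exists_inP=> -[A FA AB]; have := cross _ _ FA GB; rewrite AB.
have := expn_gt0 2 #|D|; rewrite /=.
move: (2 ^ _) #|U| #|V| #|W| #|F| #|G| FU GV => N u v w f g FU GV N0 hu hv huv.
(* By [FU] and [GV], [2 * w <= u + v], so the subtraction is not truncated. Multiplying by [N] lets
   [huv] replace [N * w] by [u * v]. *)
suff : 2 * (u + v - 2 * w) <= N by lia.
rewrite -(leq_pmul2l N0).
nia.
Qed.

End Cube.

Section Slices.

Variables (T : finType) (X1 X2 : {set T}).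
Hypothesis X_cover : X1 :|: X2 = [set: T].

Lemma trace_inj (S S' : {set T}) :
  S :&: X1 = S' :&: X1 -> S :&: X2 = S' :&: X2 -> S = S'.
Proof.
by move=> e1 e2; rewrite -[S]setIT -[S']setIT -X_cover !setIUr e1 e2.
Qed.

Definition slice (F : {set {set T}}) (B : {set T}) : {set {set T}} :=
  [set S :&: X1 | S in F & S :&: X2 == B].

(** Once the trace on [X2] is fixed, the trace on [X1] determines the set, so passing to a slice
    loses no members. *)
Lemma card_slices (F : {set {set T}}) : #|F| = \sum_(B in powerset X2) #|slice F B|.
Proof.
rewrite -sum1_card (partition_big (fun S => S :&: X2) (mem (powerset X2))) /=.
  apply: eq_bigr => B _; rewrite sum1_card /slice card_in_imset; last first.
    move=> S S'; rewrite !inE => /andP[_ /eqP e] /andP[_ /eqP e'] e1.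
    by apply: trace_inj => //; rewrite e.
  by apply: eq_card => S; rewrite !inE.
by move=> S _; rewrite inE subsetIr.
Qed.

Lemma card_one_part_le (F : {set {set T}}) : X1 != set0 -> X2 != set0 ->
  one_part_intersecting_sperner X1 X2 F -> 4 * #|F| <= 2 ^ (#|X1| + #|X2|).
Proof.
move=> X1_neq0 X2_neq0 sysF.
(* Complementation permutes the subsets of [X2]; this second count of [F] pairs each slice with its
   opposite. *)
have compl : #|F| = \sum_(B in powerset X2) #|slice F (X2 :\: B)|.
  rewrite card_slices (reindex_onto (fun B => X2 :\: B) (fun B => X2 :\: B)) /=.
    apply: eq_bigl => B; rewrite !inE subsetDl /=; apply/eqP/idP.
      by move<-; apply: subsetDl.
    exact: setDK.
  by move=> B; rewrite inE => /setDK.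
have slice_sub B : slice F B \subset powerset X1.
  by apply/subsetP=> _ /imsetP[S _ ->]; rewrite inE subsetIr.
have slice_int B : {in slice F B &, forall A A' : {set T}, A != A' -> ~~ [disjoint A & A']}.
  move=> _ _ /imsetP[S + ->] /imsetP[S' + ->].
  rewrite !inE => /andP[FS /eqP e] /andP[FS' /eqP e'] neq.
  have nSS' : S != S' by apply: contraNneq neq => ->.
  have [h _] := sysF _ _ FS FS' nSS'; apply/negP=> dis; apply: h.
  by rewrite /disjoint_on /contained_on e e' subxx.
have slice_cross (B : {set T}) : B \subset X2 -> {in slice F B & slice F (X2 :\: B),
    forall A A' : {set T}, ~~ ((A \subset A') || (A' \subset A))}.
  move=> BX _ _ /imsetP[S + ->] /imsetP[S' + ->].
  rewrite !inE => /andP[FS /eqP e] /andP[FS' /eqP e'].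
  have nSS' : S != S'.
    (* A common member would force [B = X2 :\: B], possible only for empty [X2]. *)
    apply: contraNneq X2_neq0 => eS; apply/eqP/setP=> y.
    have /setP/(_ y) : B = X2 :\: B by rewrite -[LHS]e -e' eS.
    by rewrite !inE; case: (y \in B); case: (y \in X2).
  have [_ h] := sysF _ _ FS FS' nSS'; apply/negP=> cont; apply: h.
  split=> //; rewrite /disjoint_on e e' disjoints_subset setCD.
  exact: subsetUr.
have : 2 * (#|F| + #|F|) <= #|powerset X2| * 2 ^ #|X1|.
  rewrite {1}card_slices compl -big_split big_distrr /= -sum_nat_const.
  apply: leq_sum => B; rewrite inE => BX.
  by apply: card_cross_sperner_intersecting => //; apply: slice_cross.
rewrite card_powerset expnD; lia.
Qed.

End Slices.

Lemma card_containing2 (T : finType) (x y : T) : x != y ->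
  #|[set S : {set T} | (x \in S) && (y \in S)]| = 2 ^ (#|T| - 2).
Proof.
move=> nxy; have <- : #|~: [set x; y]| = #|T| - 2 by rewrite cardsCs setCK cards2 nxy.
rewrite -card_powerset -[RHS](card_in_imset (f := fun S => [set x; y] :|: S)).
  apply: eq_card => S; rewrite !inE; apply/idP/imsetP.
    move=> xyS; exists (S :\: [set x; y]); first by rewrite inE setDE subsetIr.
    by rewrite setDE setUIr setUCr setIT; apply/esym/setUidPr; rewrite subUset !sub1set.
  by case=> S' _ ->; rewrite !inE !eqxx orbT.
move=> S S'; rewrite !inE => /setIidPl e /setIidPl e' eS.
by rewrite -e -e' -!setDE -[S :\: _]set0U -[S' :\: _]set0U -(setDv [set x; y]) -!setDUl eS.
Qed.

Theorem theorem4 (T : finType) (X1 X2 : {set T}) (F : {set {set T}})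
    (X_cover : X1 :|: X2 = [set: T]) (X_disjoint : [disjoint X1 & X2])
    (X1_neq0 : X1 != set0) (X2_neq0 : X2 != set0)
    (F_max : maximum_one_part_intersecting_sperner X1 X2 F) :
  #|F| = 2 ^ (#|T| - 2).
Proof.
have [sysF maxF] := F_max.
have cardX : #|X1| + #|X2| = #|T|.
  by move: X_disjoint; rewrite -leq_card_setU X_cover cardsT => /eqP.
have X1_gt0 : 0 < #|X1| by rewrite card_gt0.
have X2_gt0 : 0 < #|X2| by rewrite card_gt0.
apply/eqP; rewrite eqn_leq; apply/andP; split.
  have := card_one_part_le T X1 X2 X_cover F X1_neq0 X2_neq0 sysF.
  (* Both parts are nonempty, so [2 <= #|T|] and the exponent [#|T| - 2] is exact. *)
  rewrite cardX -{1}(@subnK 2 #|T|) ?expnD; last by lia.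
  by lia.
have [x xX1] := set0Pn _ X1_neq0; have [y yX2] := set0Pn _ X2_neq0.
have nxy : x != y.
  by apply: contraTneq xX1 => ->; rewrite (disjointFl X_disjoint).
(* Any two sets through [x] and [y] have meeting traces on both parts, so neither forbidden
   configuration occurs. *)
rewrite -(card_containing2 _ _ _ nxy); apply: maxF => S S'.
rewrite !inE => /andP[xS yS] /andP[xS' yS'] _.
have meet z (Z : {set T}) : z \in Z -> z \in S -> z \in S' -> ~~ disjoint_on Z S S'.
  by move=> zZ zS zS'; apply/pred0Pn; exists z; rewrite /= !inE zS zS' zZ.
by split=> -[dis _]; move: dis; apply/negP; [apply: (meet x) | apply: (meet y)].
Qed.
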